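(* Let $p_{\rm data}$ be a probability density on $\mathbb{R}^d$, $\gamma=\mathcal{N}(0,I_d)$, and $\Phi:\mathbb{R}^d\to\mathbb{R}^d$ a measurable one-to-one map with $\Phi_\#\gamma$ having a density. Fix $y$ and a measurable likelihood $x_0\mapsto p(y\mid x_0)\ge0$ with $\sup_{x_0}p(y\mid x_0)<\infty$, $Z_y:=\int p(y\mid x)p_{\rm data}(x)dx>0$ and $\int p(y\mid x)\Phi_\#\gamma(x)dx>0$. Let $p_{0,y}\propto p(y\mid x_0)p_{\rm data}(x_0)$ be the true posterior, let $\tilde p_{1,y}(x_1)\propto p(y\mid\Phi(x_1))\gamma(x_1)$ be the noise-space model posterior, and let $\tilde p_{1,y}^S$ be any probability distribution on $\mathbb{R}^d$; set $\tilde p_{0,y}^S:=\Phi_\#\tilde p_{1,y}^S$. If $\mathrm{TV}(p_{\rm data},\Phi_\#\gamma)\le\varepsilon$ and $\mathrm{TV}(\tilde p_{1,y},\tilde p_{1,y}^S)\le\varepsilon_S$, then $$\mathrm{TV}(p_{0,y},\tilde p_{0,y}^S)\le 2\kappa_y\varepsilon+\varepsilon_S,\qquad \kappa_y:=\frac{\sup_{x_0}p(y\mid x_0)}{\int p(y\mid x)p_{\rm data}(x)\,dx}.$$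
   Context: $\propto$ denotes equality up to a normalizing constant making the density integrate to one. For a measurable map $T$ and distribution $P$, $T_\#P(A)=P(T^{-1}A)$ is the push-forward. $\mathrm{TV}(P,Q)=\sup_A|P(A)-Q(A)|$, equal to $\frac12\int|p-q|$ for densities. Note $\Phi_\#\tilde p_{1,y}$ is the model posterior $\propto p(y\mid x_0)\Phi_\#\gamma(x_0)$. *)

(* Defs.v *)
(* R^d is modelled as d.-tuple R with the library's
   product (coordinate-generated = Borel) sigma-algebra. *)
From HB Require Import structures.
From mathcomp Require Import all_boot all_order all_algebra.
From mathcomp Require Import all_classical all_reals all_analysis.
Set Implicit Arguments. Unset Strict Implicit. Unset Printing Implicit Defensive.
Import Order.TTheory GRing.Theory Num.Theory.
Local Open Scope classical_set_scope.
Local Open Scope ring_scope.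
Local Open Scope ereal_scope.

Section defs.
Variable R : realType.

(* Lebesgue integral over R^n of a (nonnegative) function, computed as the
   iterated one-dimensional Lebesgue integral (equal to the n-dimensional
   Lebesgue integral for nonnegative measurable functions by Tonelli). *)
Fixpoint intRd (n : nat) : (n.-tuple R -> \bar R) -> \bar R :=
  match n with
  | 0 => fun f => f [tuple]
  | n'.+1 => fun f =>
      (\int[@lebesgue_measure R]_x intRd (fun t : n'.-tuple R => f [tuple of x :: t]))
  end.

Definition dens_meas (n : nat) (f : n.-tuple R -> R) (A : set (n.-tuple R)) : \bar R :=
  intRd (fun x => ((\1_A x)%R * f x)%:E).

Definition gauss_pdf (n : nat) (x : n.-tuple R) : R :=
  (\prod_(i < n) normal_pdf 0 1 (tnth x i))%R.

Definition pushf (n : nat) (Phi : n.-tuple R -> n.-tuple R)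
  (P : set (n.-tuple R) -> \bar R) (A : set (n.-tuple R)) : \bar R :=
  P (Phi @^-1` A).

Definition TV (n : nat) (P Q : set (n.-tuple R) -> \bar R) : \bar R :=
  ereal_sup [set `|P A - Q A| | A in [set A : set (n.-tuple R) | measurable A]].

End defs.

(* Main.v *)
Require Import Defs.
From HB Require Import structures.
From mathcomp Require Import all_boot all_order all_algebra.
From mathcomp Require Import all_classical all_reals all_analysis.
From mathcomp Require Import measurable_realfun.
From mathcomp Require Import ring lra.
Set Implicit Arguments. Unset Strict Implicit. Unset Printing Implicit Defensive.
Import Order.TTheory GRing.Theory Num.Theory.
Local Open Scope classical_set_scope.
Local Open Scope ring_scope.
Local Open Scope ereal_scope.

(* Let q be the density of Phi_# gamma.  The push-forward Phi_# p~_{1,y} of the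
   noise-space model posterior is the posterior L q / Z_q of the model, while
   p_{0,y} = L p_data / Z_p.  For a test function 0 <= g <= M, splitting the
   space along {q < p_data} gives |int g p_data - int g q| <= M eps.  Taking
   g = L and g = 1_A L controls both the normalizing constants and the
   unnormalized masses of A, and |a / Z_p - b / Z_q| <= 2 M eps / Z_p whenever
   0 <= b <= Z_q, which gives TV(p_{0,y}, Phi_# p~_{1,y}) <= 2 kappa_y eps.
   The sampling error eps_S is added by the triangle inequality, since pushing
   forward along Phi does not increase the total variation distance. *)

(* The library declares this instance inside a section only. *)
Lemma sigma_finite_product_measure d1 d2 (T1 : measurableType d1)
    (T2 : measurableType d2) (R : realType)
    (m1 : {sigma_finite_measure set T1 -> \bar R})
    (m2 : {sigma_finite_measure set T2 -> \bar R}) :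
  sigma_finite setT (m1 \x m2).
Proof.
have /sigma_finiteP[F [TF ndF Foo]] := sigma_finiteT m1.
have /sigma_finiteP[G [TG ndG Goo]] := sigma_finiteT m2.
exists (fun n => F n `*` G n).
  rewrite -setXTT TF TG predeqE => -[x y]; split.
    move=> [/= [n _ Fnx] [k _ Gky]]; exists (maxn n k) => //; split.
    - by move: x Fnx; exact/subsetPset/ndF/leq_maxl.
    - by move: y Gky; exact/subsetPset/ndG/leq_maxr.
  by move=> [n _ []/= ? ?]; split; exists n.
move=> k; have [? ?] := Foo k; have [? ?] := Goo k.
split; first exact: measurableX.
by rewrite product_measure1E// lte_mul_pinfty// ge0_fin_numE.
Qed.

Lemma sigma_finite_pushforward d1 d2 (T1 : measurableType d1)
    (T2 : measurableType d2) (R : realType)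
    (m : {measure set T1 -> \bar R}) (f : T1 -> T2) (g : T2 -> T1) :
  sigma_finite setT m -> measurable_fun setT g -> cancel f g ->
  sigma_finite setT (pushforward m f).
Proof.
move=> [F TF mF] mg fK; exists (fun k => g @^-1` F k).
  apply/seteqP; split => // t _.
  have : setT (g t) by [].
  by rewrite TF => -[k _ Fk]; exists k.
move=> k; have [mFk mFk_fin] := mF k; split.
  by rewrite -[X in measurable X]setTI; exact: mg.
rewrite /pushforward (_ : f @^-1` _ = F k)//.
by apply/seteqP; split => x /=; rewrite fK.
Qed.

Section lebesgue_tuple.
Variable R : realType.
Local Notation leb := (@lebesgue_measure R).

Definition tcons n (p : R * n.-tuple R) : n.+1.-tuple R := [tuple of p.1 :: p.2].
Definition tuncons n (t : n.+1.-tuple R) : R * n.-tuple R := (thead t, [tuple of behead t]).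

Lemma measurable_tcons n : measurable_fun setT (@tcons n).
Proof. exact: measurable_cons. Qed.

Lemma measurable_tuncons n : measurable_fun setT (@tuncons n).
Proof.
apply/measurable_fun_pairP; split; last exact: measurable_behead.
exact: (@measurable_tnth _ _ n.+1 ord0).
Qed.

Lemma tconsK n : cancel (@tcons n) (@tuncons n).
Proof. by case=> x t; congr pair; apply: val_inj. Qed.

Section cons_measure.
Variables (n : nat) (m : {sigma_finite_measure set (n.-tuple R) -> \bar R}).

(* The library's measure instance on [pushforward] takes the measurability of
   the map as an argument and so is never inferred; hence the proofs below. *)
Definition cons_measure := pushforward (leb \x m) (@tcons n).

Let cons_measure0 : cons_measure set0 = 0.
Proof. by rewrite /cons_measure /pushforward preimage_set0 measure0. Qed.

Let cons_measure_ge0 A : 0 <= cons_measure A.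
Proof. by rewrite /cons_measure /pushforward; exact: measure_ge0. Qed.

Let cons_measure_sigma_additive : semi_sigma_additive cons_measure.
Proof.
move=> F mF tF mUF; rewrite /cons_measure /pushforward preimage_bigcup.
have mcons A : measurable A -> measurable (@tcons n @^-1` A).
  by move=> mA; rewrite -[X in measurable X]setTI; exact: measurable_tcons.
apply: measure_semi_sigma_additive => [k||]; first exact: mcons.
  apply/trivIsetP => /= i j _ _ ij; rewrite -preimage_setI.
  by move/trivIsetP : tF => /(_ _ _ _ _ ij) ->//; rewrite preimage_set0.
by rewrite -preimage_bigcup; exact: mcons.
Qed.

HB.instance Definition _ := isMeasure.Build _ _ _ cons_measure
  cons_measure0 cons_measure_ge0 cons_measure_sigma_additive.

HB.instance Definition _ := Measure_isSigmaFinite.Build _ _ _ cons_measure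
  (sigma_finite_pushforward (sigma_finite_product_measure leb m)
     (@measurable_tuncons n) (@tconsK n)).

End cons_measure.

Fixpoint lebesgue_tuple n : {sigma_finite_measure set (n.-tuple R) -> \bar R} :=
  match n with
  | 0 => [the {sigma_finite_measure set _ -> \bar R} of \d_([tuple] : 0.-tuple R)]
  | n'.+1 => [the {sigma_finite_measure set _ -> \bar R} of cons_measure (lebesgue_tuple n')]
  end.

(* Tonelli, one coordinate at a time *)
Lemma intRd_lebesgue_tuple n (f : n.-tuple R -> \bar R) :
  measurable_fun [set: n.-tuple R] f -> (forall x, 0 <= f x) ->
  intRd f = \int[lebesgue_tuple n]_x f x.
Proof.
elim: n f => [|n IH] f mf f0.
  rewrite /= integral_dirac// diracT mul1e.
  by congr f; apply: val_inj; case: ([tuple] : 0.-tuple R) => -[].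
have mfcons : measurable_fun setT (f \o @tcons n).
  exact: measurableT_comp mf (@measurable_tcons n).
rewrite /= ge0_integral_pushforward//; last exact: measurable_tcons.
rewrite preimage_setT fubini_tonelli1// => [|? /=]; last exact: f0.
apply: eq_integral => x _; apply: IH => //.
apply: measurableT_comp mf _.
exact: (@measurable_cons _ _ (n.-tuple R) R (cst x) n id).
Qed.

End lebesgue_tuple.

Record density d (T : measurableType d) (R : realType) := Density {
  density_fun :> T -> R;
  measurable_density : measurable_fun setT density_fun;
  density_ge0 : forall x, (0 <= density_fun x)%R }.

Definition density_measure d (T : measurableType d) (R : realType)
    (mu : {measure set T -> \bar R}) (f : density T R) (A : set T) : \bar R :=
  \int[mu]_(x in A) (f x)%:E.

Section density_measure.
Context d (T : measurableType d) (R : realType) (mu : {measure set T -> \bar R}).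
Variable f : density T R.
Local Notation nu := (density_measure mu f).

Let mf : measurable_fun setT (EFin \o f).
Proof. exact/measurable_EFinP/measurable_density. Qed.

Let nu0 : nu set0 = 0. Proof. exact: integral_set0. Qed.

Let nu_ge0 A : 0 <= nu A.
Proof. by apply: integral_ge0 => x _; rewrite lee_fin density_ge0. Qed.

Let nu_sigma_additive : semi_sigma_additive nu.
Proof. by apply: semi_sigma_additive_nng_induced => // x; rewrite lee_fin density_ge0. Qed.

HB.instance Definition _ := isMeasure.Build _ _ _ nu nu0 nu_ge0 nu_sigma_additive.

Import HBNNSimple.

Lemma integral_density_measure_nnsfun (h : {nnsfun T >-> R}) :
  \int[nu]_x (h x)%:E = \int[mu]_x ((h x)%:E * (f x)%:E).
Proof.
have f0 x : 0 <= (f x)%:E by rewrite lee_fin density_ge0.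
have hE x : (h x)%:E = \sum_(r \in range h) (r * \1_(h @^-1` [set r]) x)%:E.
  by rewrite fsumEFin// -fimfunE.
have ind0 r x : 0 <= (r * \1_(h @^-1` [set r]) x)%:E.
  by rewrite EFinM nnfun_muleindic_ge0.
have mind r : measurable_fun setT (fun x => (r * \1_(h @^-1` [set r]) x)%:E).
  by apply/measurable_EFinP; exact: measurable_funM.
transitivity (\sum_(r \in range h) \int[nu]_x (r * \1_(h @^-1` [set r]) x)%:E).
  by under eq_integral do rewrite hE; rewrite ge0_integral_fsum.
transitivity (\sum_(r \in range h)
    \int[mu]_x ((r * \1_(h @^-1` [set r]) x)%:E * (f x)%:E)); last first.
  rewrite -ge0_integral_fsum//; last by move=> r x; rewrite mule_ge0.
    by apply: eq_integral => x _; rewrite hE ge0_mule_fsuml.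
  by move=> r; apply: emeasurable_funM.
apply: eq_fsbigr => r /[!inE] -[t _ <-].
under [RHS]eq_integral do rewrite EFinM -muleA.
rewrite integralZl_indic_nnsfun// ge0_integralZl//.
- congr (_ * _); rewrite integral_indic// setIT.
  transitivity (\int[mu]_(x in h @^-1` [set h t]) (f x)%:E) => //.
  by rewrite integral_mkcond; apply: eq_integral => x _; rewrite epatch_indic muleC.
- by apply: emeasurable_funM => //; exact/measurable_EFinP.
- by move=> x _; rewrite mule_ge0// lee_fin.
- by rewrite lee_fin.
Qed.

Lemma integral_density_measure (h : T -> \bar R) :
  (forall x, 0 <= h x) -> measurable_fun setT h ->
  \int[nu]_x h x = \int[mu]_x (h x * (f x)%:E).
Proof.
move=> h0 mh; pose hn := nnsfun_approx measurableT mh.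
have hn_cvg x : (hn k x)%:E @[k --> \oo] --> h x.
  exact: cvg_nnsfun_approx.
have hn_nd x : {homo (fun k => (hn k x)%:E) : a b / (a <= b)%N >-> a <= b}.
  by move=> a b ab; rewrite lee_fin; exact/lefP/nd_nnsfun_approx.
have mhn k : measurable_fun setT (fun x => (hn k x)%:E).
  exact/measurable_EFinP/measurable_funP.
have -> : \int[nu]_x h x = limn (fun k => \int[nu]_x (hn k x)%:E).
  under eq_integral do rewrite -(cvg_lim _ (hn_cvg _))//.
  by apply: monotone_convergence => // k x _; rewrite lee_fin.
have -> : \int[mu]_x (h x * (f x)%:E) =
    limn (fun k => \int[mu]_x ((hn k x)%:E * (f x)%:E)).
  under eq_integral => x _.
    rewrite -(cvg_lim _ (cvgeZr (y := (f x)%:E) isT (hn_cvg x)))//; over.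
  apply: monotone_convergence => //.
  - by move=> k; exact: emeasurable_funM.
  - by move=> k x _; rewrite mule_ge0 ?lee_fin ?density_ge0.
  - by move=> x _ a b ab; apply: lee_wpmul2r; [rewrite lee_fin density_ge0|exact: hn_nd].
by congr (limn _); apply/funext => k; exact: integral_density_measure_nnsfun.
Qed.

End density_measure.

Lemma integral_pushforward_density d1 d2 (T1 : measurableType d1)
    (T2 : measurableType d2) (R : realType) (mu1 : {measure set T1 -> \bar R})
    (mu2 : {measure set T2 -> \bar R}) (Phi : T1 -> T2)
    (g : density T1 R) (q : density T2 R) :
  measurable_fun setT Phi ->
  (forall A, measurable A ->
     density_measure mu1 g (Phi @^-1` A) = density_measure mu2 q A) ->
  forall h : T2 -> \bar R, measurable_fun setT h -> (forall x, 0 <= h x) ->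
  \int[mu1]_x (h (Phi x) * (g x)%:E) = \int[mu2]_x (h x * (q x)%:E).
Proof.
move=> mPhi push h mh h0.
rewrite -integral_density_measure//; last exact: measurableT_comp.
rewrite -integral_density_measure//.
transitivity (\int[pushforward (density_measure mu1 g) Phi]_x h x).
  by rewrite ge0_integral_pushforward// preimage_setT.
apply: eq_measure_integral => A mA _ /=.
by rewrite /pushforward push.
Qed.

Lemma normr_indic_le1 T (R : numDomainType) (A : set T) x : (`|\1_A x| <= 1 :> R)%R.
Proof. by rewrite indicE; case: (x \in A); rewrite ?normr1 ?normr0. Qed.

Section bounded_test_functions.
Context d (T : measurableType d) (R : realType) (mu : {measure set T -> \bar R}).
Local Open Scope ring_scope.

Lemma integrableM_bounded (g p : T -> R) (M : R) :
  measurable_fun setT g -> (forall x, `|g x| <= M) ->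
  mu.-integrable setT (EFin \o p) -> mu.-integrable setT (EFin \o (g \* p)).
Proof.
move=> mg gM ip.
have gbd : [bounded g x | x in setT].
  by exists M; split; [exact: num_real|move=> y My x _; exact: le_trans (gM x) (ltW _)].
have := integrableMr measurableT mg gbd ip.
by apply: eq_integrable => // x _; rewrite /= EFinM.
Qed.

Variables (p q : T -> R).
Hypotheses (mp : measurable_fun setT p) (mq : measurable_fun setT q).
Hypotheses (p0 : forall x, 0 <= p x) (q0 : forall x, 0 <= q x).
Hypotheses (ip : mu.-integrable setT (EFin \o p))
           (iq : mu.-integrable setT (EFin \o q)).

(* The witness set is [S = {q < p}], on which [(M - g)(p - q) >= 0]. *)
Lemma Rintegral_bounded_subr_le (g : T -> R) (M e : R) : 0 <= M ->
  measurable_fun setT g -> (forall x, 0 <= g x <= M) ->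
  (forall S, measurable S ->
     \int[mu]_x (\1_S x * p x) - \int[mu]_x (\1_S x * q x) <= e) ->
  \int[mu]_x (g x * p x) - \int[mu]_x (g x * q x) <= M * e.
Proof.
move=> M0 mg gM pqS.
pose S := [set x | q x < p x].
have mS : measurable S.
  by rewrite -[S]setTI; exact: (measurable_fun_ltr mq mp measurableT (Y:=[set true])).
have normgM x : `|g x| <= M by have /andP[g0 gM'] := gM x; rewrite ger0_norm.
have norm1M x : `|M * \1_S x| <= M.
  by rewrite normrM ger0_norm// ler_piMr// normr_indic_le1.
have mMS : measurable_fun setT (fun x => M * \1_S x).
  exact: measurable_funM.
have ig f : mu.-integrable setT (EFin \o f) -> mu.-integrable setT (EFin \o (g \* f)).
  exact: integrableM_bounded mg normgM.
have iS f : mu.-integrable setT (EFin \o f) ->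
    mu.-integrable setT (EFin \o ((fun x => M * \1_S x) \* f)).
  exact: integrableM_bounded mMS norm1M.
have intMS f : mu.-integrable setT (EFin \o f) ->
    \int[mu]_x ((fun x => M * \1_S x) \* f) x = M * \int[mu]_x (\1_S x * f x).
  move=> ifn; rewrite -RintegralZl//.
    by apply: eq_Rintegral => x _; rewrite /= mulrA.
  by apply: (integrableM_bounded _ _ ifn) => [|x]; [exact: measurable_indic|exact: normr_indic_le1].
have pointwise x : g x * p x + M * \1_S x * q x <= g x * q x + M * \1_S x * p x.
  have /andP[g0 gM'] := gM x; have := p0 x; have := q0 x.
  rewrite indicE; case: (boolP (x \in S)) => [|/negP]; rewrite inE /S /=.
    by move=> qp q0x p0x; rewrite mulr1; nra.
  by move=> /negP; rewrite -leNgt => pq q0x p0x; rewrite mulr0 !mul0r !addr0; nra.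
have := le_Rintegral measurableT (integrableD measurableT (ig _ ip) (iS _ iq))
  (integrableD measurableT (ig _ iq) (iS _ ip)) (fun x _ => pointwise x).
rewrite !RintegralD//; try exact: ig; try exact: iS.
rewrite !intMS// => ineq.
have := ler_wpM2l M0 (pqS S mS); rewrite mulrBr; lra.
Qed.

End bounded_test_functions.

Section normalized_densities.
Local Open Scope ring_scope.

Lemma dist_divr_le (R : realFieldType) (a b Zp Zq c : R) :
  0 < Zp -> 0 < Zq -> 0 <= b <= Zq ->
  `|a - b| <= c -> `|Zp - Zq| <= c -> `|a / Zp - b / Zq| <= 2 * c / Zp.
Proof.
move=> Zp0 Zq0 /andP[b0 bZq] ab ZpZq.
pose t := b / Zq.
have t01 : 0 <= t <= 1.
  by apply/andP; split; [rewrite divr_ge0 // ltW|rewrite ler_pdivrMr // mul1r].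
have -> : a / Zp - b / Zq = ((a - b) + t * (Zq - Zp)) / Zp.
  by rewrite /t; field; rewrite !gt_eqF.
rewrite normrM [`|Zp^-1|]gtr0_norm ?invr_gt0// ler_pM2r ?invr_gt0//.
rewrite (le_trans (ler_normD _ _))// normrM ger0_norm; last by case/andP: t01.
have : `|Zq - Zp| <= c by rewrite distrC.
have : 0 <= `|Zq - Zp| := normr_ge0 _.
case/andP: t01 => t0 t1; nra.
Qed.

Context d (T : measurableType d) (R : realType) (mu : {measure set T -> \bar R}).
Variables (p q : T -> R) (e : R).
Hypotheses (mp : measurable_fun setT p) (mq : measurable_fun setT q).
Hypotheses (p0 : forall x, 0 <= p x) (q0 : forall x, 0 <= q x).
Hypotheses (ip : mu.-integrable setT (EFin \o p))
           (iq : mu.-integrable setT (EFin \o q)).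
Hypothesis pq_sets : forall S, measurable S ->
  `|\int[mu]_x (\1_S x * p x) - \int[mu]_x (\1_S x * q x)| <= e.

Lemma dist_Rintegral_bounded_le (g : T -> R) (M : R) : 0 <= M ->
  measurable_fun setT g -> (forall x, 0 <= g x <= M) ->
  `|\int[mu]_x (g x * p x) - \int[mu]_x (g x * q x)| <= M * e.
Proof.
move=> M0 mg gM; rewrite ler_norml; apply/andP; split.
  rewrite lerNl opprB; apply: Rintegral_bounded_subr_le => // S mS.
  by apply: le_trans (pq_sets mS); rewrite distrC ler_norm.
apply: Rintegral_bounded_subr_le => // S mS.
exact: le_trans (ler_norm _) (pq_sets mS).
Qed.

Variables (L : T -> R) (M : R).
Hypotheses (mL : measurable_fun setT L) (M0 : 0 <= M)
           (LM : forall x, 0 <= L x <= M).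
Let Zp := \int[mu]_x (L x * p x).
Let Zq := \int[mu]_x (L x * q x).

Lemma dist_normalized_le A : measurable A -> 0 < Zp -> 0 < Zq ->
  `|\int[mu]_x (\1_A x * L x * p x) / Zp - \int[mu]_x (\1_A x * L x * q x) / Zq|
    <= 2 * (M / Zp) * e.
Proof.
move=> mA Zp0 Zq0.
have mAL : measurable_fun setT (fun x => \1_A x * L x) by exact: measurable_funM.
have AL x : 0 <= \1_A x * L x <= L x.
  have /andP[L0 _] := LM x.
  by rewrite indicE; case: (x \in A); rewrite ?mul1r ?mul0r ?lexx ?L0.
have ALM x : 0 <= \1_A x * L x <= M.
  by have /andP[-> ALx] := AL x; have /andP[_ /(le_trans ALx)] := LM x.
have normLM x : `|L x| <= M by case/andP: (LM x) => ? ?; rewrite ger0_norm.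
have normALM x : `|\1_A x * L x| <= M by case/andP: (ALM x) => ? ?; rewrite ger0_norm.
have b_ge0 : 0 <= \int[mu]_x (\1_A x * L x * q x).
  by apply: Rintegral_ge0 => x _; rewrite mulr_ge0 //; case/andP: (AL x).
have b_le : \int[mu]_x (\1_A x * L x * q x) <= Zq.
  apply: le_Rintegral => //; try exact: integrableM_bounded iq.
  by move=> x _; rewrite ler_wpM2r//; case/andP: (AL x).
rewrite (_ : 2 * (M / Zp) * e = 2 * (M * e) / Zp); last by rewrite !mulrA mulrAC.
apply: dist_divr_le => //; first by rewrite b_ge0 b_le.
  exact: dist_Rintegral_bounded_le.
exact: dist_Rintegral_bounded_le.
Qed.

End normalized_densities.

Section densities_on_tuples.
Variables (R : realType) (n : nat).
Local Notation T := (n.-tuple R).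
Local Notation lam := (lebesgue_tuple R n).

Lemma intRd_integrable (g : T -> R) : measurable_fun setT g -> (forall x, (0 <= g x)%R) ->
  intRd (fun x => (g x)%:E) < +oo -> lam.-integrable setT (EFin \o g).
Proof.
move=> mg g0 gfin; apply/integrableP; split; first exact/measurable_EFinP.
under eq_integral do rewrite gee0_abs ?lee_fin//.
by rewrite -intRd_lebesgue_tuple//; exact/measurable_EFinP.
Qed.

Lemma intRd_bounded_mul (g f : T -> R) (K : R) :
  measurable_fun setT g -> (forall x, (0 <= g x)%R) -> (forall x, (`|g x| <= K)%R) ->
  measurable_fun setT f -> (forall x, (0 <= f x)%R) -> lam.-integrable setT (EFin \o f) ->
  intRd (fun x => (g x * f x)%:E) = (\int[lam]_x (g x * f x))%:E.
Proof.
move=> mg g0 gK mf f0 intf; rewrite intRd_lebesgue_tuple; first last.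
- by move=> x; rewrite lee_fin mulr_ge0.
- exact/measurable_EFinP/measurable_funM.
by rewrite fineK//; exact/integrable_fin_num/(integrableM_bounded mg gK).
Qed.

Lemma dens_meas_divr (f : T -> R) (c : R) A : measurable A ->
  measurable_fun setT f -> (forall x, (0 <= f x)%R) -> (0 <= c)%R ->
  dens_meas (fun x => f x / c)%R A = intRd (fun x => (\1_A x * f x)%:E) * (c^-1)%:E.
Proof.
move=> mA mf f0 c0.
have mAf : measurable_fun setT (fun x => (\1_A x * f x)%:E).
  exact/measurable_EFinP/measurable_funM.
have Af0 x : 0 <= (\1_A x * f x)%:E by rewrite lee_fin mulr_ge0.
have mAfc : measurable_fun setT (fun x => (\1_A x * (f x / c))%:E).
  by apply/measurable_EFinP/measurable_funM => //; exact: measurable_funM.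
rewrite /dens_meas !intRd_lebesgue_tuple//.
  under eq_integral do rewrite mulrA EFinM.
  by rewrite ge0_integralZr// lee_fin invr_ge0.
by move=> x; rewrite lee_fin mulrA divr_ge0 ?mulr_ge0.
Qed.

Lemma dens_meas_density_measure (f : density T R) A : measurable A ->
  dens_meas f A = density_measure lam f A.
Proof.
move=> mA; rewrite /dens_meas intRd_lebesgue_tuple; first last.
- by move=> x; rewrite lee_fin mulr_ge0 ?density_ge0.
- by apply/measurable_EFinP/measurable_funM => //; exact: measurable_density.
rewrite /density_measure integral_mkcond; apply: eq_integral => x _.
by rewrite epatch_indic EFinM muleC.
Qed.

Lemma intRd_pushf_density (Phi : T -> T) (g q : density T R) :
  measurable_fun setT Phi ->
  (forall A, measurable A -> pushf Phi (dens_meas g) A = dens_meas q A) ->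
  forall h : T -> R, measurable_fun setT h -> (forall x, (0 <= h x)%R) ->
  intRd (fun x => (h (Phi x) * g x)%:E) = intRd (fun x => (h x * q x)%:E).
Proof.
move=> mPhi push h mh h0.
have mdens (f : density T R) (k : T -> R) : measurable_fun setT k ->
    measurable_fun setT (fun x => (k x * f x)%:E).
  by move=> mk; apply/measurable_EFinP/measurable_funM => //; exact: measurable_density.
have dens0 (f : density T R) (k : T -> R) : (forall x, (0 <= k x)%R) ->
    forall x, 0 <= (k x * f x)%:E.
  by move=> k0 x; rewrite lee_fin mulr_ge0 ?density_ge0.
rewrite !intRd_lebesgue_tuple;
  [|exact: mdens|exact: dens0|exact: mdens (measurableT_comp mh mPhi)|exact: dens0].
under eq_integral do rewrite EFinM.
under [RHS]eq_integral do rewrite EFinM.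
apply: integral_pushforward_density => //; last exact/measurable_EFinP.
move=> A mA; rewrite -!dens_meas_density_measure//; first exact: push.
by rewrite -[X in measurable X]setTI; exact: mPhi.
Qed.

End densities_on_tuples.

Lemma measurable_gauss_pdf (R : realType) n :
  measurable_fun [set: n.-tuple R] (@gauss_pdf R n).
Proof.
apply: measurable_prod => i _; apply: measurableT_comp; first exact: measurable_normal_pdf.
exact: measurable_tnth.
Qed.

Lemma gauss_pdf_ge0 (R : realType) n (x : n.-tuple R) : (0 <= gauss_pdf x)%R.
Proof. by apply: prodr_ge0 => i _; exact: normal_pdf_ge0. Qed.

Definition gauss_density (R : realType) n : density (n.-tuple R) R :=
  Density (@measurable_gauss_pdf R n) (@gauss_pdf_ge0 R n).

Section posterior_perturbation.
Variables (R : realType) (d : nat).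
Local Notation T := (d.-tuple R).
Local Notation lam := (lebesgue_tuple R d).
Local Notation gauss := (@gauss_pdf R d).
Variables (pdata q L : T -> R) (Phi : T -> T) (M eps : R).
Hypotheses (mpdata : measurable_fun setT pdata)
  (pdata_ge0 : forall x, (0 <= pdata x)%R)
  (pdata1 : intRd (fun x => (pdata x)%:E) = 1).
Hypotheses (mPhi : measurable_fun setT Phi) (mq : measurable_fun setT q)
  (q_ge0 : forall x, (0 <= q x)%R)
  (push : forall A, measurable A -> pushf Phi (dens_meas gauss) A = dens_meas q A).
Hypotheses (mL : measurable_fun setT L) (LM : forall x, (0 <= L x <= M)%R).
Hypothesis TVdata : TV (dens_meas pdata) (pushf Phi (dens_meas gauss)) <= eps%:E.

Let M_ge0 : (0 <= M)%R.
Proof. by have /andP[L0 LM'] := LM [tuple of nseq d 0%R]; exact: le_trans L0 LM'. Qed.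

Let L_ge0 x : (0 <= L x)%R. Proof. by case/andP: (LM x). Qed.

Let normL x : (`|L x| <= M)%R.
Proof. by have /andP[L0 LM'] := LM x; rewrite ger0_norm. Qed.

Let indicL_ge0 (A : set T) x : (0 <= \1_A x * L x)%R.
Proof. by rewrite mulr_ge0. Qed.

Let normr_indicL (A : set T) x : (`|\1_A x * L x| <= M)%R.
Proof. by rewrite normrM (le_trans _ (normL x))// ler_piMl ?normr_indic_le1. Qed.

Let dens_meas_setT (f : T -> R) : dens_meas f setT = intRd (fun x => (f x)%:E).
Proof. by rewrite /dens_meas indicT; congr intRd; apply/funext => x; rewrite mul1r. Qed.

Lemma integrable_pdata : lam.-integrable setT (EFin \o pdata).
Proof. by rewrite intRd_integrable// pdata1 ltry. Qed.

(* q has finite mass because it is at finite total variation distance from p_data *)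
Lemma integrable_q : lam.-integrable setT (EFin \o q).
Proof.
apply: intRd_integrable => //.
have : `|1 - intRd (fun x => (q x)%:E)| <= eps%:E.
  apply: le_trans TVdata.
  rewrite -pdata1 -!dens_meas_setT -push//; apply: ereal_sup_ubound.
  by exists [set: T]; [exact: measurableT|].
have : 0 <= intRd (fun x => (q x)%:E).
  rewrite intRd_lebesgue_tuple; [|exact/measurable_EFinP|by move=> x; rewrite lee_fin].
  by apply: integral_ge0 => x _; rewrite lee_fin.
by case: (intRd _) => // r; rewrite ltry.
Qed.

Lemma dist_indic_Rintegral_le S : measurable S ->
  (`|\int[lam]_x (\1_S x * pdata x) - \int[lam]_x (\1_S x * q x)| <= eps)%R.
Proof.
move=> mS; rewrite -lee_fin -abse_EFin EFinB.
rewrite -!(intRd_bounded_mul (K := 1%R)) ?integrable_pdata ?integrable_q//;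
  try exact: normr_indic_le1.
apply: le_trans TVdata.
rewrite -[intRd _]/(dens_meas pdata S) -[intRd (fun x => _)]/(dens_meas q S) -push//.
by apply: ereal_sup_ubound; exists S.
Qed.

Lemma intRd_L_pdata : intRd (fun x => (L x * pdata x)%:E) = (\int[lam]_x (L x * pdata x))%:E.
Proof. by apply: intRd_bounded_mul => //; exact: integrable_pdata. Qed.

Lemma intRd_L_q : intRd (fun x => (L x * q x)%:E) = (\int[lam]_x (L x * q x))%:E.
Proof. by apply: intRd_bounded_mul => //; exact: integrable_q. Qed.

Lemma intRd_L_model :
  intRd (fun x => (L (Phi x) * gauss x)%:E) = (\int[lam]_x (L x * q x))%:E.
Proof.
rewrite -intRd_L_q.
exact: (intRd_pushf_density (g := gauss_density R d) (q := Density mq q_ge0)).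
Qed.

Lemma posterior_dens_meas (c : R) A : measurable A -> (0 <= c)%R ->
  dens_meas (fun x => L x * pdata x / c)%R A =
  ((\int[lam]_x (\1_A x * L x * pdata x)) / c)%:E.
Proof.
move=> mA c0; rewrite dens_meas_divr//; last 2 first.
- exact: measurable_funM.
- by move=> x; rewrite mulr_ge0.
under eq_fun do rewrite mulrA.
rewrite (intRd_bounded_mul (K := M)) ?EFinM//; last exact: integrable_pdata.
exact: measurable_funM.
Qed.

Lemma model_posterior_dens_meas (c : R) A : measurable A -> (0 <= c)%R ->
  dens_meas (fun x => L (Phi x) * gauss x / c)%R (Phi @^-1` A) =
  ((\int[lam]_x (\1_A x * L x * q x)) / c)%:E.
Proof.
move=> mA c0; rewrite dens_meas_divr//; last 3 first.
- by rewrite -[X in measurable X]setTI; exact: mPhi.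
- by apply: measurable_funM; [exact: measurableT_comp|exact: measurable_gauss_pdf].
- by move=> x; rewrite mulr_ge0 ?gauss_pdf_ge0.
under eq_fun do rewrite mulrA.
have mAL : measurable_fun setT (fun x => \1_A x * L x)%R by exact: measurable_funM.
rewrite (intRd_pushf_density (g := gauss_density R d) (q := Density mq q_ge0) mPhi push mAL)//.
by rewrite (intRd_bounded_mul (K := M)) ?EFinM//; exact: integrable_q.
Qed.

Lemma posterior_dist_le A : measurable A ->
  (0 < \int[lam]_x (L x * pdata x))%R -> (0 < \int[lam]_x (L x * q x))%R ->
  (`|\int[lam]_x (\1_A x * L x * pdata x) / \int[lam]_x (L x * pdata x)
     - \int[lam]_x (\1_A x * L x * q x) / \int[lam]_x (L x * q x)|
   <= 2 * (M / \int[lam]_x (L x * pdata x)) * eps)%R.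
Proof.
exact: (dist_normalized_le mpdata mq pdata_ge0 q_ge0 integrable_pdata integrable_q
  dist_indic_Rintegral_le mL M_ge0 LM).
Qed.

End posterior_perturbation.

Theorem corollary1 (R : realType) (d : nat)
  (pdata : d.-tuple R -> R)
  (Phi : d.-tuple R -> d.-tuple R)
  (q : d.-tuple R -> R)            (* density of Phi_# gamma *)
  (L : d.-tuple R -> R)            (* x0 |-> p(y | x0), y fixed *)
  (PS1 : probability (d.-tuple R) R)
  (eps epsS : R) :
  measurable_fun [set: d.-tuple R] pdata ->
  (forall x, (0 <= pdata x)%R) ->
  intRd (fun x => (pdata x)%:E) = 1 ->
  measurable_fun [set: d.-tuple R] Phi ->
  injective Phi ->
  measurable_fun [set: d.-tuple R] q ->
  (forall x, (0 <= q x)%R) ->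
  (forall A, measurable A ->
     pushf Phi (dens_meas (@gauss_pdf R d)) A = dens_meas q A) ->
  measurable_fun [set: d.-tuple R] L ->
  (forall x, (0 <= L x)%R) ->
  (exists M : R, forall x, (L x <= M)%R) ->
  0 < intRd (fun x => (L x * pdata x)%:E) ->
  0 < intRd (fun x => (L x * q x)%:E) ->
  TV (dens_meas pdata) (pushf Phi (dens_meas (@gauss_pdf R d))) <= eps%:E ->
  let Z1 := fine (intRd (fun x => (L (Phi x) * gauss_pdf x)%:E)) in
  let p1 := fun A : set (d.-tuple R) =>
     dens_meas (fun x => L (Phi x) * gauss_pdf x / Z1)%R A in
  TV p1 (PS1 : set _ -> \bar R) <= epsS%:E ->
  let Zy := fine (intRd (fun x => (L x * pdata x)%:E)) in
  let p0 := fun A : set (d.-tuple R) =>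
     dens_meas (fun x => L x * pdata x / Zy)%R A in
  let kappa := (sup (range L) / Zy)%R in
  TV p0 (pushf Phi (PS1 : set _ -> \bar R)) <= (2 * kappa * eps + epsS)%:E.
Proof.
move=> mpdata pdata_ge0 pdata1 mPhi _ mq q_ge0 push mL L_ge0 [M0 LM0] Zy_gt0 Z1_gt0
  TVdata Z1 p1 TVS /=.
set Zy := fine _; set M := sup _.
have LM x : (0 <= L x <= M)%R.
  by rewrite L_ge0; apply: ub_le_sup; [exists M0 => _ [y _ <-]; exact: LM0|exists x].
have intLp := intRd_L_pdata mpdata pdata_ge0 pdata1 mL LM.
have intLq := intRd_L_q pdata1 mq q_ge0 push mL LM TVdata.
have ZyE : Zy = (\int[lebesgue_tuple R d]_x (L x * pdata x))%R by rewrite /Zy intLp.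
have Z1E : Z1 = (\int[lebesgue_tuple R d]_x (L x * q x))%R.
  by move: (intRd_L_model pdata1 mPhi mq q_ge0 push mL LM TVdata) => /(congr1 fine).
rewrite intLp lte_fin in Zy_gt0; rewrite intLq lte_fin in Z1_gt0.
apply: ge_ereal_sup => _ [A mA <-].
have mPA : measurable (Phi @^-1` A) by rewrite -[X in measurable X]setTI; exact: mPhi.
have PS1E : PS1 (Phi @^-1` A) = (fine (PS1 (Phi @^-1` A)))%:E.
  by rewrite fineK// fin_num_measure.
have TVS_A : (`|(\int[lebesgue_tuple R d]_x (\1_A x * L x * q x)) / Z1
    - fine (PS1 (Phi @^-1` A))| <= epsS)%R.
  rewrite -lee_fin -abse_EFin EFinB -PS1E.
  rewrite -(model_posterior_dens_meas pdata1 mPhi mq q_ge0 push mL LM TVdata (c := Z1) mA);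
    last by rewrite Z1E ltW.
  by apply: le_trans TVS; apply: ereal_sup_ubound; exists (Phi @^-1` A).
rewrite (posterior_dens_meas mpdata pdata_ge0 pdata1 mL LM (c := Zy) mA);
  last by rewrite ZyE ltW.
rewrite /pushf PS1E -EFinB abse_EFin lee_fin ZyE; rewrite Z1E in TVS_A.
apply: le_trans (ler_distD _ _ _) (lerD _ TVS_A).
exact: (posterior_dist_le mpdata pdata_ge0 pdata1 mq q_ge0 push mL LM TVdata mA Zy_gt0 Z1_gt0).
Qed.
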